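(* For every integer $n\ge 0$, $$\sum_{j=0}^{\infty}(-1)^{\lceil j/2\rceil}\,pod(n-T_j)=\begin{cases}1,&\text{if } n=0,\\ 0,&\text{otherwise.}\end{cases}$$
   Context: $pod(n)$ denotes the number of partitions of the nonnegative integer $n$ in which odd parts are distinct and even parts are unrestricted (may be repeated), with $pod(0)=1$ and $pod(m)=0$ for $m<0$. For $j\ge 0$, $T_j=\frac{j(j+1)}{2}$ is the $j$-th triangular number. *)

(* Defs.v *)
From mathcomp Require Import all_boot all_order all_algebra.

Set Implicit Arguments.
Unset Strict Implicit.
Unset Printing Implicit Defensive.

Import GRing.Theory.

Definition is_partition (n : nat) (s : seq nat) : bool :=
  [&& sorted geq s, all (fun k => 0 < k) s & sumn s == n].

Definition odd_parts_distinct (s : seq nat) : bool := uniq [seq k <- s | odd k].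

(* A partition of n has at most n parts, each at most n, so the finite type of
   sequences of length at most n over 'I_n.+1 contains every partition of n
   (exactly once): see is_partition_bseq. *)
Definition pod_partitions (n : nat) : {set n.-bseq 'I_n.+1} :=
  [set s : n.-bseq 'I_n.+1 | let t := [seq val i | i <- s] in
     is_partition n t && odd_parts_distinct t].

Definition pod (m : int) : nat :=
  match m with
  | Posz n => #|pod_partitions n|
  | Negz _ => 0
  end.

Definition triangular (j : nat) : nat := (j * j.+1) %/ 2.

(* The value of an infinite series of integers: convergence in the discrete
   space int means that the partial sums are eventually constant. *)
Definition has_sum (u : nat -> int) (l : int) : Prop :=
  exists N : nat, forall M : nat, N <= M -> (\sum_(0 <= j < M) u j)%R = l.

Lemma is_partition_bseq (n : nat) (s : seq nat) : is_partition n s ->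
  exists! t : n.-bseq 'I_n.+1, [seq val i | i <- t] = s.
Proof.
case/and3P=> _ pos_s /eqP sum_s.
have size_s : size s <= n.
  rewrite -sum_s; elim: s pos_s {sum_s} => //= k s IHs /andP[k_gt0 /IHs].
  by rewrite -add1n; apply: leq_add.
have bound_s : {in s, forall k, k <= n}.
  move=> k; rewrite -sum_s; elim: s {pos_s sum_s size_s} => //= a s IHs.
  rewrite inE => /predU1P[->|/IHs le_k]; first exact: leq_addr.
  exact: leq_trans le_k (leq_addl _ _).
have size_t : size [seq inord k : 'I_n.+1 | k <- s] <= n by rewrite size_map.
exists (Bseq size_t); split=> [|t' def_s] /=.
  rewrite -map_comp -[RHS]map_id; apply/eq_in_map => k /bound_s le_k_n /=.
  by rewrite inordK.
apply: val_inj => /=; rewrite -def_s -map_comp -[RHS]map_id.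
by apply: eq_map => i /=; rewrite inord_val.
Qed.

Lemma pod0 : pod 0 = 1.
Proof.
apply/eqP/cards1P; exists (@Bseq 0 _ [::] isT).
apply/setP=> t; rewrite !inE.
by case: t => [[|//] ?]; rewrite -val_eqE.
Qed.

(* Main.v *)
(* Since (-1)^ceil(j/2) = (-1)^(T_j), the claim is Gauss' identity
     sum_j (-q)^(T_j) = prod_k (1 - q^(2k)) / (1 + q^(2k-1)),
   whose right-hand side is the inverse of the generating function of pod.
   We use Shanks' finite form, with D_n = prod_(k <= n) (1 + q^(2k-1)):
     D_n sum_(j < 2n) (-q)^(T_j)
       = sum_(s < n) D_s prod_(s < k <= n) (1 - q^(2k)) (-1)^s q^(s(2n+1)),
   a telescoping identity of polynomials.  Modulo q^(2n+1) only the term s = 0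
   survives, and prod_(k <= n) (1 - q^(2k)) / D_n is the inverse of the
   generating function of the pod-partitions with all parts at most 2n. *)

Require Import Defs.
From mathcomp Require Import all_boot all_order all_algebra.
From mathcomp Require Import zify ring.

Set Implicit Arguments.
Unset Strict Implicit.
Unset Printing Implicit Defensive.

Import GRing.Theory.

Local Open Scope ring_scope.

(** * Pod-partitions with bounded parts and the recurrence for their number *)

Definition pod_le (b m : nat) (s : seq nat) : bool :=
  [&& is_partition m s, odd_parts_distinct s & all (leq^~ b) s].

(* An odd largest part x cannot recur, so the other parts are at most x - 1. *)
Lemma pod_le_cons b m x s :
  pod_le b m (x :: s) =
    [&& (0 < x <= b)%N, (x <= m)%N & pod_le (x - odd x) (m - x) s].
Proof.
have geq_trans : transitive geq.
  by move=> y z t /= le_yz le_ty; apply: leq_trans le_ty le_yz.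
have allx : [&& all (leq^~ x) s, all (leq^~ b) s, (x <= b)%N
               & odd x ==> (x \notin s)]
            = (x <= b)%N && all (leq^~ (x - odd x)%N) s.
  case: (leqP x b) => [le_xb|_]; last by rewrite !andbF.
  apply/and4P/allP => [[/allP les _ _ xs] y ys /=|les].
    have := les _ ys; case: (odd x) xs => /= [xs|_]; last by rewrite subn0.
    have: y != x by apply: contraNneq xs => <-.
    by move=> /=; lia.
  split=> //; first by apply/allP => y /les /=; lia.
  - by apply/allP => y /les /=; lia.
  - by apply/implyP => ox; apply/negP => /les /=;
    have := odd_gt0 ox; rewrite ox; lia.
rewrite /pod_le /is_partition /odd_parts_distinct /= path_sortedE //.
have -> : uniq (if odd x then x :: filter odd s else filter odd s) =
          (odd x ==> (x \notin s)) && uniq (filter odd s).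
  by case: ifP => //= ox; rewrite mem_filter ox.
have -> : (x + sumn s == m)%N = (x <= m)%N && (sumn s == m - x)%N by lia.
have -> : all (geq x) s = all (leq^~ x) s by apply: eq_all.
move: allx.
case: (all (leq^~ x) s); case: (all (leq^~ b) s); case: (x <= b)%N;
  case: (odd x ==> _); case: (all (leq^~ (x - _)%N) s) => //= _;
  rewrite ?andbF ?andbT //;
  by case: (sorted _ _); case: (all _ _); case: (0 < x)%N; case: (x <= m)%N;
    case: (sumn s == _).
Qed.

Lemma pod_le0 m s : pod_le 0 m s = (m == 0)%N && (s == [::]).
Proof.
case: s => [|x s]; first by rewrite /pod_le /= /is_partition /= !andbT eq_sym.
by rewrite pod_le_cons; case: x => [|x] /=; rewrite ?andbF.
Qed.

(** The largest part is either at most [b] or equal to [b.+1]. The default head [0] is never [b.+1],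
    so the empty sequence falls under the first case. *)
Lemma pod_le_recr b m s :
  pod_le b.+1 m s =
    pod_le b m s || [&& (b < m)%N, head 0%N s == b.+1
                      & pod_le (b.+1 - odd b.+1) (m - b.+1) (behead s)].
Proof.
case: s => [|x s]; first by rewrite /pod_le !andbF orbF.
rewrite !pod_le_cons /= [(x <= b.+1)%N]leq_eqVlt ltnS.
case: eqVneq => [->|_]; first by rewrite ltnn.
by rewrite !andbF orbF.
Qed.

Lemma pod_le_is_partition b m s : (m <= b)%N ->
  pod_le b m s = is_partition m s && odd_parts_distinct s.
Proof.
move=> le_mb; rewrite /pod_le; case: (boolP (is_partition m s)) => //= Hs.
rewrite andbC; case: allP => //= -[] k ks.
have /and3P[_ _ /eqP sum_s] := Hs.
apply: leq_trans le_mb; rewrite -sum_s; move: ks {Hs sum_s}.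
elim: s => //= a s IHs; rewrite inE => /predU1P[->|/IHs le_k].
  exact: leq_addr.
exact: leq_trans le_k (leq_addl _ _).
Qed.

(** Plain sequences are listed because the bounded-sequence type depends on [m], whereas the
    recurrence mixes different values of [m]. *)
Definition pod_le_seqs (b m : nat) : seq (seq nat) :=
  [seq s <- [seq [seq val i | i <- t] | t : m.-bseq 'I_m.+1]
     | pod_le b m s].

Lemma map_val_bseq_inj m :
  injective (fun t : m.-bseq 'I_m.+1 => [seq val i | i <- t]).
Proof. by move=> s t /(inj_map val_inj); apply: val_inj. Qed.

Lemma pod_le_seqs_uniq b m : uniq (pod_le_seqs b m).
Proof.
apply: filter_uniq; rewrite map_inj_uniq ?enum_uniq //.
exact: map_val_bseq_inj.
Qed.

Lemma mem_pod_le_seqs b m s : (s \in pod_le_seqs b m) = pod_le b m s.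
Proof.
rewrite mem_filter andbC.
case: (boolP (pod_le b m s)) => [|_]; last exact: andbF.
case/and3P=> /is_partition_bseq[t [<- _]] _ _; rewrite andbT.
by apply/mapP; exists t; rewrite ?mem_enum.
Qed.

Definition pod_le_count (b m : nat) : nat := size (pod_le_seqs b m).

Lemma pod_le_count0 m : pod_le_count 0 m = (m == 0)%N.
Proof.
rewrite /pod_le_count; have [m0|m0] := eqVneq m 0%N.
  rewrite (perm_size (uniq_perm (pod_le_seqs_uniq 0 m)
    (isT : uniq [:: [::]]) _)) //.
  by move=> s; rewrite mem_pod_le_seqs pod_le0 m0 inE.
rewrite (perm_size (uniq_perm (pod_le_seqs_uniq 0 m) (isT : uniq [::]) _)) //.
by move=> s; rewrite mem_pod_le_seqs pod_le0 (negPf m0).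
Qed.

Lemma pod_le_countS b m :
  pod_le_count b.+1 m =
    (pod_le_count b m
     + if (b < m)%N then pod_le_count (b.+1 - odd b.+1) (m - b.+1) else 0)%N.
Proof.
(* The guard matters: for [m <= b] the subtraction [m - b.+1] truncates to 0 and would wrongly admit
   the empty remainder. *)
pose l := if (b < m)%N then pod_le_seqs (b.+1 - odd b.+1) (m - b.+1) else [::].
have -> : (if (b < m)%N then pod_le_count (b.+1 - odd b.+1) (m - b.+1) else 0)%N
          = size [seq b.+1 :: s | s <- l].
  by rewrite size_map /l; case: ifP.
rewrite -size_cat; apply/perm_size/uniq_perm; first exact: pod_le_seqs_uniq.
  rewrite cat_uniq pod_le_seqs_uniq map_inj_uniq => [|s t []//].
  rewrite andTb; apply/andP; split; last first.
    by rewrite /l; case: ifP; rewrite ?pod_le_seqs_uniq.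
  apply/hasPn => _ /mapP[s _ ->].
  by rewrite mem_pod_le_seqs pod_le_cons ltnn !andbF.
move=> s; rewrite mem_cat !mem_pod_le_seqs pod_le_recr; congr (_ || _).
apply/and3P/mapP => [[lt_bm hd_s tl_s]|[t]]; last first.
  rewrite /l; case: ifP => // lt_bm; rewrite mem_pod_le_seqs => tP ->.
  by rewrite eqxx.
exists (behead s); first by rewrite /l lt_bm mem_pod_le_seqs.
by case: s hd_s {tl_s} => //= x s /eqP->.
Qed.

Lemma pod_le_count_pod b m : (m <= b)%N -> pod_le_count b m = pod m.
Proof.
move=> le_mb; rewrite /pod_le_count /pod_le_seqs filter_map size_map /pod.
rewrite cardE [in RHS]/enum_mem enumT; congr size; apply: eq_filter => t /=.
by rewrite inE pod_le_is_partition.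
Qed.

(** * Congruence modulo a power of the variable, and truncated generating functions *)

Definition eqmodX (R : nzRingType) (K : nat) (p q : {poly R}) : Prop :=
  forall i, (i < K)%N -> p`_i = q`_i.

Lemma eqmodX_mul (R : nzRingType) K (p p' q q' : {poly R}) :
  eqmodX K p p' -> eqmodX K q q' -> eqmodX K (p * q) (p' * q').
Proof.
move=> Ep Eq i lt_iK; rewrite !coefM; apply: eq_bigr => j _.
by rewrite Ep ?Eq //; have := ltn_ord j; lia.
Qed.

Lemma eqmodX_cancel (R : nzRingType) K (p q q' : {poly R}) :
  p`_0 = 1 -> eqmodX K (p * q) (p * q') -> eqmodX K q q'.
Proof.
move=> p0 Epq; elim/ltn_ind => i IHi lt_iK; have := Epq i lt_iK.
rewrite !coefM !big_ord_recl p0 !mul1r !subn0.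
rewrite (eq_bigr (fun j : 'I_i =>
  p`_(lift ord0 j) * q'`_(i - lift ord0 j))).
  exact: addIr.
move=> j _; rewrite IHi //=; have := ltn_ord j; rewrite /bump /=; lia.
Qed.

Definition pod_poly (K b : nat) : {poly int} :=
  \poly_(i < K) (pod_le_count b i)%:Z.

(** The even part [b.+1] may recur, so removing one copy leaves the bound at [b.+1]: a geometric
    series. *)
Lemma pod_poly_even K b : odd b ->
  eqmodX K ((1 - 'X^(b.+1)) * pod_poly K b.+1) (pod_poly K b).
Proof.
move=> ob i lt_iK; rewrite mulrBl mul1r coefB coefXnM !coef_poly lt_iK.
rewrite (leq_ltn_trans (leq_subr _ _) lt_iK) pod_le_countS /= ob subn0.
by rewrite ltnS; case: leqP => _; rewrite ?subr0 ?addn0 // PoszD addrK.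
Qed.

(** The odd part [b.+1] occurs at most once, and removing it lowers the bound to [b]. *)
Lemma pod_poly_odd K b : ~~ odd b ->
  eqmodX K (pod_poly K b.+1) ((1 + 'X^(b.+1)) * pod_poly K b).
Proof.
move=> ob i lt_iK; rewrite mulrDl mul1r coefD coefXnM !coef_poly lt_iK.
rewrite (leq_ltn_trans (leq_subr _ _) lt_iK) pod_le_countS /= (negPf ob).
rewrite subn1 ltnS.
by case: leqP => _; rewrite ?addr0 ?addn0 // PoszD.
Qed.

Definition odd_prod (n : nat) : {poly int} :=
  \prod_(0 <= k < n) (1 + 'X^(k.*2.+1)).

Definition even_prod (s n : nat) : {poly int} :=
  \prod_(s <= k < n) (1 - 'X^(k.*2.+2)).

Lemma even_prod_pod_poly K n :
  eqmodX K (even_prod 0 n * pod_poly K n.*2) (odd_prod n).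
Proof.
elim: n => [|n IHn].
  rewrite /even_prod /odd_prod !big_nil mul1r => i lt_iK.
  by rewrite coef_poly lt_iK pod_le_count0 coef1; case: (i == 0)%N.
rewrite /even_prod /odd_prod !big_nat_recr //= -/(even_prod 0 n) -/(odd_prod n).
rewrite -mulrA doubleS => i lt_iK.
have oS : odd n.*2.+1 by rewrite /= odd_double.
rewrite (@eqmodX_mul _ K _ _ _ _ (fun i _ => erefl) (pod_poly_even oS)) //.
have eS : ~~ odd n.*2 by rewrite odd_double.
rewrite (@eqmodX_mul _ K _ _ _ _ (fun i _ => erefl) (pod_poly_odd eS)) //.
rewrite mulrCA mulrC.
by rewrite (@eqmodX_mul _ K _ _ _ _ IHn (fun i _ => erefl)).
Qed.

(** * Triangular numbers and the partial sums of Gauss' series *)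

Lemma triangularE j : triangular j = 'C(j.+1, 2).
Proof. by rewrite /triangular bin2 /= mulnC -divn2. Qed.

Lemma triangularS j : triangular j.+1 = (triangular j + j.+1)%N.
Proof. by rewrite !triangularE binS bin1. Qed.

Lemma triangular_double n : triangular n.*2 = (n * n.*2.+1)%N.
Proof. by rewrite /triangular -muln2 mulnAC mulnK // mulnC. Qed.

Lemma leq_triangular j : (j <= triangular j)%N.
Proof. by case: j => // j; rewrite triangularS; lia. Qed.

Definition gauss_sum (m : nat) : {poly int} :=
  \sum_(0 <= j < m) (-1) ^+ uphalf j *: 'X^(triangular j).

(** The new terms [j = 2n] and [j = 2n + 1] have opposite signs, and their exponents differ by
    [2n + 1]. *)
Lemma gauss_sum_doubleS n :
  gauss_sum n.+1.*2
  = gauss_sum n.*2 + (-1) ^+ n * 'X^(n * n.*2.+1) * (1 - 'X^(n.*2.+1)).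
Proof.
rewrite /gauss_sum doubleS !big_nat_recr //= -addrA; congr (_ + _).
rewrite triangularS triangular_double uphalf_half doubleK odd_double add0n.
rewrite exprS exprD -!mul_polyC !rmorphM !rmorphXn !rmorphN rmorph1; ring.
Qed.

(** * Shanks' finite identity *)

Definition shanks_term (n s : nat) : {poly int} :=
  odd_prod s * even_prod s n * ((-1) ^+ s * 'X^(s * n.*2.+1)).

Lemma odd_prodS n : odd_prod n.+1 = odd_prod n * (1 + 'X^(n.*2.+1)).
Proof. by rewrite /odd_prod big_nat_recr. Qed.

Lemma even_prodS s n : (s <= n)%N ->
  even_prod s n.+1 = even_prod s n * (1 - 'X^(n.*2.+2)).
Proof. by move=> le_sn; rewrite /even_prod big_nat_recr. Qed.

Lemma even_prod_recl s n : (s < n)%N ->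
  even_prod s n = (1 - 'X^(s.*2.+2)) * even_prod s.+1 n.
Proof. by move=> lt_sn; rewrite /even_prod big_ltn. Qed.

(** The right-hand side is a difference of consecutive values of
    [(1 - 'X^(s.*2)) * shanks_term n s], so summing over [s] telescopes. *)
Lemma shanks_term_step n s : (s < n)%N ->
  shanks_term n.+1 s - (1 + 'X^(n.*2.+1)) * shanks_term n s =
  (1 - 'X^(s.+1.*2)) * shanks_term n s.+1 - (1 - 'X^(s.*2)) * shanks_term n s.
Proof.
move=> lt_sn.
rewrite /shanks_term odd_prodS even_prodS ?(ltnW lt_sn) //.
rewrite !(even_prod_recl lt_sn).
have -> : (s * n.+1.*2.+1 = s * n.*2.+1 + s.*2)%N by lia.
have -> : (n.*2.+2 = n.*2.+1 + 1)%N by lia.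
rewrite mulSn doubleS -[s.*2.+2]addn2 -[s.*2.+1]addn1 !exprD.
rewrite [(-1) ^+ s.+1]exprS.
(* With the exponents split, only an identity in independent variables remains. *)
move: 'X^(n.*2.+1) 'X^(s.*2) 'X^(s * _) => x y z; ring.
Qed.

Lemma shanks_identity n :
  odd_prod n * gauss_sum n.*2 = \sum_(0 <= s < n) shanks_term n s.
Proof.
elim: n => [|n IHn]; first by rewrite /gauss_sum !big_nil mulr0.
rewrite gauss_sum_doubleS odd_prodS mulrDr mulrAC IHn.
rewrite big_nat_recr //=.
have -> : \sum_(0 <= s < n) shanks_term n.+1 s
        = (1 + 'X^(n.*2.+1)) * (\sum_(0 <= s < n) shanks_term n s)
          + (1 - 'X^(n.*2)) * shanks_term n n.
  (* The lower boundary term vanishes because [1 - 'X^0 = 0]; the upper one is at [s = n]. *)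
  apply/eqP; rewrite addrC -subr_eq mulr_sumr -sumrB.
  rewrite (eq_big_nat _ _
    (fun s lt_sn => shanks_term_step (proj2 (andP lt_sn)))).
  rewrite (telescope_sumr (fun s => (1 - 'X^(s.*2)) * shanks_term n s)) //.
  by rewrite expr0 subrr mul0r subr0.
have even1 : even_prod n n = 1 by rewrite /even_prod big_geq.
rewrite /shanks_term even_prodS // even1.
have -> : (n * n.+1.*2.+1 = n * n.*2.+1 + n.*2)%N by lia.
rewrite -[n.*2.+2]addn2 -[n.*2.+1]addn1 !exprD.
(* Up to a common factor, this is [1 - q^(4n+2) = (1 - q^(2n)) + q^(2n) (1 - q^(2n+2))]. *)
move: 'X^(n.*2) 'X^(n * _) => x y; ring.
Qed.

(** Each term with [s > 0] is divisible by ['X^(n.+1.*2.+1)]. *)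
Lemma shanks_sum_eqmodX n :
  eqmodX n.+1.*2.+1 (\sum_(0 <= s < n.+1) shanks_term n.+1 s)
    (even_prod 0 n.+1).
Proof.
rewrite big_nat_recl // => i lt_i.
rewrite coefD coef_sum big1_seq => [|s _].
  by rewrite addr0 /shanks_term /odd_prod big_nil mul0n expr0 !(mul1r, mulr1).
rewrite /shanks_term [_ * ((-1) ^+ _ * _)]mulrA coefMXn ifT //; lia.
Qed.

(* uphalf j is the ceiling of j / 2. *)
Theorem theorem3p1 (n : nat) :
  has_sum
    (fun j : nat => (-1) ^+ uphalf j * (pod (n%:Z - (triangular j)%:Z))%:Z)
    (if n == 0%N then 1 else 0).
Proof.
(* Precision [n.+1] just reaches the coefficient of ['X^n], and the bound [N.*2] on the parts
   excludes no partition of a number up to [n]. *)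
pose N := n.+1; pose G := pod_poly N N.*2.
have GS1 : eqmodX N (G * gauss_sum N.*2) 1.
  have E0 : (even_prod 0 N)`_0 = 1.
    rewrite -horner_coef0 horner_prod big1_seq // => k _.
    by rewrite hornerD hornerN hornerXn hornerC expr0n subr0.
  (* After multiplication by [even_prod 0 N], the left side becomes [odd_prod N * gauss_sum N.*2],
     to which Shanks' identity applies. *)
  apply: (eqmodX_cancel E0) => i lt_iN; rewrite mulr1 mulrA.
  rewrite (eqmodX_mul (@even_prod_pod_poly N N) (fun i _ => erefl)) //.
  by rewrite shanks_identity shanks_sum_eqmodX //; lia.
(* For [j >= N.*2] one has [triangular j >= j > n], so [pod] is taken at a negative integer and the
   term is 0. *)
exists N.*2 => M le_M.
have -> : (if n == 0%N then 1 else 0) = (G * gauss_sum N.*2)`_n.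
  by rewrite GS1 // coef1; case: (n == 0)%N.
rewrite (@big_cat_nat _ _ _ N.*2) //=.
rewrite [X in _ + X]big_nat_cond [X in _ + X]big1 => [|j].
  rewrite addr0 mulr_sumr coef_sum; apply: eq_bigr => j _.
  rewrite -scalerAr coefZ coefMXn; congr (_ * _).
  rewrite coef_poly; case: ltnP => [lt_n|le_n].
    by case E: (n%:Z - (triangular j)%:Z) => [k|k] //; lia.
  rewrite ltnS leq_subr pod_le_count_pod; last by rewrite /N; lia.
  by rewrite -subzn.
rewrite andbT => /andP[le_j _]; have := leq_triangular j => le_T.
case E: (_ - _) => [k|k]; last by rewrite mulr0.
by lia.
Qed.
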